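(* For every $n\geq0$, $\mathsf{COH}$ admits $n$-$\mathsf{ER}$-fairness preservation: for all $A_0,A_1\subseteq\mathbb{Q}$, every set $C$ which is $n$-$\mathsf{ER}$-fair for $A_0,A_1$, and every uniformly $C$-computable sequence of sets $\vec R=\langle R_0,R_1,\dots\rangle$, there is an $\vec R$-cohesive set $G$ such that $G\oplus C$ is $n$-$\mathsf{ER}$-fair for $A_0,A_1$.
   Context: An infinite set $G\subseteq\omega$ is $\vec R$-cohesive if for each $i$, $G\subseteq^*R_i$ or $G\subseteq^*\overline{R_i}$ ($\subseteq^*$ = inclusion up to finitely many elements). Rationals are identified with natural numbers via a fixed computable coding; ''$>s$'' for rationals refers to their codes. For a finite set $S=\{x_0<_{\mathbb{Q}}\dots<_{\mathbb{Q}}x_{n-1}\}$, $\operatorname{int}_{\mathbb{Q}}(S)$ is the sequence of open intervals $(-\infty,x_0),(x_0,x_1),\dots,(x_{n-1},+\infty)$ ($\operatorname{int}_{\mathbb{Q}}(\emptyset)=\{\mathbb{Q}\}$); these are simple partitions. $\vec I$ refines $\vec J$ if each interval of $\vec I$ lies in an interval of $\vec J$; $\vec I\otimes\vec J=\{I\cap J\}$. An $m$-by-$n$ matrix $M$ is an array of rationals $x_{i,j}$ with $x_{i,j}<_{\mathbb{Q}}x_{i,k}$ for $j<k$; row $M(i)=\{x_{i,0},\dots,x_{i,n-1}\}$; $\operatorname{int}_{\mathbb{Q}}(M)=\bigotimes_{i<m}\operatorname{int}_{\mathbb{Q}}(M(i))$; an $M$-partition is a simple partition refining it. An $(\vec I,k)$-type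 is a tuple $T_0,\dots,T_{k-1}$ of intervals of $\vec I$. An $M$-formula has distinguished finite-set variables $U_j$ ($j<m$) and $C_{i,I}$ ($i<m$, $I\in\operatorname{int}_{\mathbb{Q}}(M(i))$); it is $\Sigma^{0,X}_1$ if $\Sigma^0_1$ in parameter $X$. An $M$-valuation $V$ consists of finite sets $A_j\subseteq\mathbb{Q}$ ($j<m$) and $D_{i,I}\subseteq I$; $\varphi(V)$ is the substitution. $V$ is of type $\vec T$ (an $(\vec I,m)$-type for an $M$-partition $\vec I$) if $A_j\subseteq T_j$ for all $j$; $V>s$ if all rationals occurring in $V$ have code $>s$. $\varphi$ is $\vec T$-essential if for every $s$ some $M$-valuation $V>s$ of type $\vec T$ satisfies $\varphi$; essential if $\vec T$-essential for some $M$-partition $\vec I$ and $(\vec I,m)$-type $\vec T$. $V$ diagonalizes against $A_0,A_1$ if $\bigcup_jA_j\subseteq A_1$ and for each $i<m$ some $I\in\operatorname{int}_{\mathbb{Q}}(M(i))$ has $D_{i,I}\subseteq A_0$. $X$ is $n$-$\mathsf{ER}$-fair for $A_0,A_1$ if for every $m$, every $m$-by-$2^nm$ matrix $M$ and every essential $\Sigma^{0,X}_1$ $M$-formula $\varphi$, some $M$-valuation diagonalizing against $A_0,A_1$ satisfies $\varphi$. *)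

(* Defs.v *)
From HB Require Import structures.
From mathcomp Require Import all_boot all_order all_algebra.
From mathcomp Require Import finmap.
From mathcomp Require Import mathcomp_extra boolp classical_sets cardinality.

Set Implicit Arguments.
Unset Strict Implicit.
Unset Printing Implicit Defensive.

Import Order.TTheory.

Local Open Scope nat_scope.

(* The functions recursive in X, following Kleene: the least class of total   *)
(* functions containing the initial functions and the characteristic function *)
(* of X, closed under composition, primitive recursion and minimization of    *)
(* regular functions (the first clause of rec_min ensures that the search     *)
(* always succeeds).                                                          *)
Inductive recursive_in (X : set nat) : forall k, (k.-tuple nat -> nat) -> Prop :=
| rec_zero : recursive_in X (fun _ : 0.-tuple nat => 0)
| rec_succ : recursive_in X (fun t : 1.-tuple nat => (thead t).+1)
| rec_proj k (i : 'I_k) : recursive_in X (fun t : k.-tuple nat => tnth t i)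
| rec_oracle : recursive_in X (fun t : 1.-tuple nat => nat_of_bool `[< X (thead t) >])
| rec_comp k l (f : l.-tuple nat -> nat) (g : 'I_l -> k.-tuple nat -> nat) :
    recursive_in X f -> (forall i, recursive_in X (g i)) ->
    recursive_in X (fun t : k.-tuple nat => f [tuple g i t | i < l])
| rec_prim k (f : k.-tuple nat -> nat) (g : k.+2.-tuple nat -> nat) :
    recursive_in X f -> recursive_in X g ->
    recursive_in X (fun t : k.+1.-tuple nat =>
      nat_rect (fun=> nat) (f [tuple of behead t])
        (fun i r => g [tuple of i :: r :: behead t]) (thead t))
| rec_min k (f : k.+1.-tuple nat -> nat) (h : k.-tuple nat -> nat) :
    recursive_in X f ->
    (forall t, f [tuple of h t :: t] = 0) ->
    (forall t y, y < h t -> f [tuple of y :: t] <> 0) ->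
    recursive_in X h.

Definition uniformly_computable (C : set nat) (R : nat -> set nat) : Prop :=
  recursive_in C
    (fun t : 2.-tuple nat => nat_of_bool `[< R (tnth t ord0) (tnth t ord_max) >]).

Definition join (G C : set nat) : set nat :=
  [set x | if odd x then C x./2 else G x./2]%classic.

Definition almost_subset (A B : set nat) : Prop := finite_set (A `\` B)%classic.

Definition cohesive (R : nat -> set nat) (G : set nat) : Prop :=
  infinite_set G /\
  forall i, almost_subset G (R i) \/ almost_subset G (~` R i)%classic.

(* Arithmetical formulas with one set parameter.  The type argument is the    *)
(* type of free number variables; a quantifier binds the variable None of     *)
(* option V.                                                                  *)
Inductive term (V : Type) : Type :=
| Var of V
| Zero
| One
| Add of term V & term V
| Mul of term V & term V.

(* Formulas in which all quantifiers are bounded, by a term over the outer    *)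
(* variables.  Finite sets of numbers are represented by their canonical      *)
(* index: InFin t u says that t belongs to the finite set with index u (this  *)
(* relation is itself definable by a bounded formula of arithmetic), whereas  *)
(* InParam t says that t belongs to the set parameter.                        *)
Inductive bformula (V : Type) : Type :=
| Eq of term V & term V
| Lt of term V & term V
| InParam of term V
| InFin of term V & term V
| Not of bformula V
| And of bformula V & bformula V
| Or of bformula V & bformula V
| AllLt of term V & bformula (option V)
| ExLt of term V & bformula (option V).

Inductive sigma1 (V : Type) : Type := Exists of bformula (option V).

Fixpoint teval (V : Type) (e : V -> nat) (t : term V) : nat :=
  match t with
  | Var v => e v
  | Zero => 0
  | One => 1
  | Add t u => teval e t + teval e u
  | Mul t u => teval e t * teval e u
  end.

(* Membership in the finite set of canonical index y = \sum_(x in F) 2 ^ x. *)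
Definition in_fin (x y : nat) : bool := odd (y %/ 2 ^ x).

Definition scons (V : Type) (x : nat) (e : V -> nat) : option V -> nat := oapp e x.

Fixpoint bsat (X : set nat) (V : Type) (p : bformula V) (e : V -> nat) : Prop :=
  match p with
  | Eq t u => teval e t = teval e u
  | Lt t u => teval e t < teval e u
  | InParam t => X (teval e t)
  | InFin t u => in_fin (teval e t) (teval e u)
  | Not p => ~ bsat X p e
  | And p q => bsat X p e /\ bsat X q e
  | Or p q => bsat X p e \/ bsat X q e
  | AllLt t p => forall x, x < teval e t -> bsat X p (scons x e)
  | ExLt t p => exists2 x, x < teval e t & bsat X p (scons x e)
  end.

Definition sat (X : set nat) (V : Type) (p : sigma1 V) (e : V -> nat) : Prop :=
  let: Exists q := p in exists x, bsat X q (scons x e).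

(* The coding of rationals by naturals is the library's injection             *)
(* pickle : rat -> nat, which is computable and has a computable range.       *)
Definition rcode (q : rat) : nat := choice.pickle q.

Definition fin_code (A : {fset rat}) : nat :=
  \sum_(q <- enum_fset A) 2 ^ rcode q.

(* The open intervals delimited by the lower bound b, then the points of s. *)
Fixpoint gaps (b : itv_bound rat) (s : seq rat) : seq (interval rat) :=
  if s is x :: s' then Interval b (BLeft x) :: gaps (BRight x) s'
  else [:: Interval b (BInfty _ false)].

Definition intQ (S : {fset rat}) : seq (interval rat) :=
  gaps (BInfty _ true) (sort <=%O (enum_fset S)).

Definition simple_partition (I : seq (interval rat)) : Prop :=
  exists S, I = intQ S.

Definition refines (I J : seq (interval rat)) : Prop :=
  forall i, i \in I -> exists2 j, j \in J & {subset i <= j}.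

(* Order.meet is the intersection of intervals.  The product may also list    *)
(* empty intersections; they play no role when it is refined by a simple      *)
(* partition, whose intervals are all nonempty.                               *)
Definition otimes (I J : seq (interval rat)) : seq (interval rat) :=
  [seq Order.meet i j | i <- I, j <- J].

Definition increasing_rows m n (M : 'M[rat]_(m, n)) : Prop :=
  forall (i : 'I_m) (j k : 'I_n), j < k -> (M i j < M i k)%O.

Definition mrow m n (M : 'M[rat]_(m, n)) (i : 'I_m) : {fset rat} :=
  [fset M i j | j : 'I_n]%fset.

Definition intM m n (M : 'M[rat]_(m, n)) : seq (interval rat) :=
  \big[otimes / intQ fset0]_(i < m) intQ (mrow M i).

(* When M has increasing rows, intQ (mrow M i) has exactly n.+1 members.      *)
Definition row_interval m n (M : 'M[rat]_(m, n)) (i : 'I_m) (k : 'I_n.+1) :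
    interval rat :=
  nth `]-oo, +oo[%O (intQ (mrow M i)) k.

Definition is_Mpartition m n (M : 'M[rat]_(m, n)) (I : seq (interval rat)) : Prop :=
  simple_partition I /\ refines I (intM M).

Definition is_type (I : seq (interval rat)) k (T : k.-tuple (interval rat)) : Prop :=
  {subset T <= I}.

(* The distinguished finite-set variables: inl j is U_j and inr (i, k) is     *)
(* C_(i, I), where I is the k-th interval of row i.                           *)
Definition Mvar m n : Type := 'I_m + 'I_m * 'I_n.+1.

Record valuation m n (M : 'M[rat]_(m, n)) := Valuation {
  valA : 'I_m -> {fset rat};
  valD : 'I_m -> 'I_n.+1 -> {fset rat};
  valD_sub : forall i k, {subset valD i k <= row_interval M i k}
}.

Definition val_env m n (M : 'M[rat]_(m, n)) (V : valuation M) (v : Mvar m n) : nat :=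
  match v with
  | inl j => fin_code (valA V j)
  | inr (i, k) => fin_code (valD V i k)
  end.

Definition Msat (X : set nat) m n (M : 'M[rat]_(m, n)) (phi : sigma1 (Mvar m n))
    (V : valuation M) : Prop :=
  sat X phi (val_env V).

Definition of_type m n (M : 'M[rat]_(m, n)) (V : valuation M)
    (T : m.-tuple (interval rat)) : Prop :=
  forall j, {subset valA V j <= tnth T j}.

Definition val_gt m n (M : 'M[rat]_(m, n)) (V : valuation M) (s : nat) : Prop :=
  (forall j q, q \in valA V j -> s < rcode q) /\
  (forall i k q, q \in valD V i k -> s < rcode q).

Definition type_essential m n (M : 'M[rat]_(m, n)) (phi : valuation M -> Prop)
    (T : m.-tuple (interval rat)) : Prop :=
  forall s, exists V : valuation M, [/\ val_gt V s, of_type V T & phi V].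

Definition essential m n (M : 'M[rat]_(m, n)) (phi : valuation M -> Prop) : Prop :=
  exists I (T : m.-tuple (interval rat)),
    [/\ is_Mpartition M I, is_type I T & type_essential phi T].

Definition diagonalizes m n (M : 'M[rat]_(m, n)) (V : valuation M)
    (A0 A1 : set rat) : Prop :=
  (forall j q, q \in valA V j -> A1 q) /\
  (forall i, exists k, forall q, q \in valD V i k -> A0 q).

Definition ER_fair (n : nat) (A0 A1 : set rat) (X : set nat) : Prop :=
  forall m (M : 'M[rat]_(m, 2 ^ n * m)) (phi : sigma1 (Mvar m (2 ^ n * m))),
    increasing_rows M -> essential (@Msat X _ _ M phi) ->
    exists2 V : valuation M, diagonalizes V A0 A1 & Msat X phi V.

(* Main.v *)
(* Mathias forcing whose reservoirs are the infinite sets that are Sigma_1    *)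
(* definable in C; such a reservoir can always be shrunk into R_i or into its *)
(* complement. Given a Sigma_1 formula phi in the parameter G + C and a       *)
(* condition, let psi say that phi holds of s + C for some finite extension s *)
(* of the condition; psi is Sigma_1 in C. If psi is essential, the fairness   *)
(* of C provides a diagonalizing valuation together with s, and by the use    *)
(* principle every G agreeing with s on a long enough initial segment         *)
(* satisfies phi at this valuation. If psi is not essential, then neither is  *)
(* phi in the parameter G + C, for any G compatible with the condition.       *)
Require Import Defs.
From mathcomp Require Import all_boot all_order all_algebra.
From mathcomp Require Import finmap.
From mathcomp Require Import boolp classical_sets cardinality.

Set Implicit Arguments.
Unset Strict Implicit.
Unset Printing Implicit Defensive.

Local Open Scope classical_set_scope.
Local Open Scope nat_scope.

(** The set G is compatible with every member of a descending sequence of conditions that meets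
    countably many dense requirements ([generic_exists], [requirement_code]): G is infinite, G is
    cohesive for each [R i], and G is fair for each pair of a matrix and a formula.

    Cohesiveness: functions recursive in C have Sigma_1 graphs ([recursive_graph]), so [R i] and its
    complement are both Sigma_1 in C. The reservoir can then be thinned to whichever of the two
    leaves it infinite, and it stays Sigma_1 ([dense_decide]).

    Fairness ([dense_fair]): whether some finite extension of the condition makes phi true is again
    a Sigma_1 question about C ([sigma1_extension]). If the formula asking it is essential, fairness
    of C yields a diagonalizing valuation together with an extension to commit to. Otherwise phi is
    not essential for any G compatible with the condition. *)

(** * Finite collection, canonical indices and the use principle *)

Lemma uniform_bound (P : nat -> nat -> Prop) (n : nat) :
  (forall x y z, y <= z -> P x y -> P x z) ->
  (forall x, x < n -> exists y, P x y) ->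
  exists y, forall x, x < n -> P x y.
Proof.
move=> Pmono; elim: n => [|n IHn] Pn; first by exists 0.
have [|y Py] := IHn; first by move=> x /ltnW; apply: Pn.
have [z Pz] := Pn n (ltnSn n).
exists (maxn y z) => x; rewrite ltnS leq_eqVlt => /predU1P[->|ltxn].
  exact: Pmono (leq_maxr _ _) Pz.
exact: Pmono (leq_maxl _ _) (Py x ltxn).
Qed.

Lemma in_fin_lt x c : in_fin x c -> x < c.
Proof.
rewrite /in_fin => cx; apply: leq_trans (ltn_expl x (ltnSn 1)) _.
by case: leqP cx => // ?; rewrite divn_small.
Qed.

Lemma in_fin_code (P : set nat) n :
  exists c, forall x, in_fin x c <-> x < n /\ P x.
Proof.
(* The bound [c < 2 ^ n] makes the induction work: adding [2 ^ n] then sets bit n without a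
   carry. *)
suff [c _ cP] : exists2 c, c < 2 ^ n & forall x, in_fin x c <-> x < n /\ P x.
  by exists c.
elim: n => [|n [c ltc cP]].
  by exists 0 => // x; rewrite /in_fin div0n; split=> // -[].
have [Pn|nPn] := pselect (P n); last first.
  exists c; first by rewrite expnS mul2n -addnn ltn_addr.
  move=> x; rewrite cP; split=> -[]; first by move/ltnW.
  by rewrite ltnS leq_eqVlt => /predU1P[->|].
exists (c + 2 ^ n); first by rewrite expnS mul2n -addnn ltn_add2r.
move=> x; rewrite ltnS /in_fin; case: (ltngtP x n) => [ltxn|ltnx|->].
- have -> : 2 ^ n = 2 ^ (n - x.+1).+1 * 2 ^ x.
    by rewrite -expnD addSnnS subnK.
  rewrite addnC divnMDl ?expn_gt0 // oddD oddX /= -/(in_fin x c) cP ltxn.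
  by split=> -[_ Px]; split=> //; apply: ltnW.
- rewrite divn_small; first by split=> // -[].
  apply: leq_trans (_ : 2 ^ n.+1 <= _); last by rewrite leq_exp2l.
  by rewrite expnS mul2n -addnn ltn_add2r.
- by rewrite divnDr // divnn expn_gt0 divn_small //.
Qed.

(** Once its free variables have values, a bounded formula queries its set parameter only finitely
    often; a bounded quantifier takes a common bound for its finitely many instances. *)
Lemma bsat_use V (p : bformula V) X e : exists n, forall X',
  (forall x, x < n -> (X x <-> X' x)) -> (bsat X p e <-> bsat X' p e).
Proof.
elim: p e => {V} V /=.
- by move=> t u e; exists 0.
- by move=> t u e; exists 0.
- by move=> t e; exists (teval e t).+1 => X'; apply.
- by move=> t u e; exists 0.
- by move=> p IHp e; have [n np] := IHp e; exists n => X' /np ->.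
- move=> p IHp q IHq e; have [n np] := IHp e; have [m mq] := IHq e.
  exists (maxn n m) => X' XX'; rewrite (np X') ?(mq X') // => x ltx; apply: XX'.
    by rewrite leq_max ltx orbT.
  by rewrite leq_max ltx.
- move=> p IHp q IHq e; have [n np] := IHp e; have [m mq] := IHq e.
  exists (maxn n m) => X' XX'; rewrite (np X') ?(mq X') // => x ltx; apply: XX'.
    by rewrite leq_max ltx orbT.
  by rewrite leq_max ltx.
- move=> t p IHp e.
  have [|x _|n np] := @uniform_bound (fun x n => forall X',
    (forall y, y < n -> (X y <-> X' y)) ->
    (bsat X p (scons x e) <-> bsat X' p (scons x e))) (teval e t).
  + move=> x y z leyz H X' XX'; apply: H => w ltw.
    exact/XX'/(leq_trans ltw).
  + exact: IHp.
  exists n => X' XX'; split=> H x ltx;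
    have := np x ltx X' XX'; have := H x ltx; tauto.
- move=> t p IHp e.
  have [|x _|n np] := @uniform_bound (fun x n => forall X',
    (forall y, y < n -> (X y <-> X' y)) ->
    (bsat X p (scons x e) <-> bsat X' p (scons x e))) (teval e t).
  + move=> x y z leyz H X' XX'; apply: H => w ltw.
    exact/XX'/(leq_trans ltw).
  + exact: IHp.
  exists n => X' XX'; split=> -[x ltx Hx]; exists x => //;
    have := np x ltx X' XX'; tauto.
Qed.

(** * Renaming of variables, and functions given by terms *)

Fixpoint tren V W (f : V -> W) (t : term V) : term W :=
  match t with
  | Var v => Var (f v)
  | Zero => @Zero W
  | One => @One W
  | Add t u => Add (tren f t) (tren f u)
  | Mul t u => Mul (tren f t) (tren f u)
  end.

Fixpoint bren V W (f : V -> W) (p : bformula V) : bformula W :=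
  match p with
  | Eq t u => Eq (tren f t) (tren f u)
  | Lt t u => Lt (tren f t) (tren f u)
  | InParam t => InParam (tren f t)
  | InFin t u => InFin (tren f t) (tren f u)
  | Not p => Not (bren f p)
  | And p q => And (bren f p) (bren f q)
  | Or p q => Or (bren f p) (bren f q)
  | AllLt t p => AllLt (tren f t) (bren (omap f) p)
  | ExLt t p => ExLt (tren f t) (bren (omap f) p)
  end.

Lemma teval_ren V W (f : V -> W) t e : teval e (tren f t) = teval (e \o f) t.
Proof. by elim: t => //= t -> u ->. Qed.

Lemma scons_ren V W (f : V -> W) x e :
  scons x e \o omap f = scons x (e \o f).
Proof. by apply: funext => -[]. Qed.

Lemma bsat_ren X V W (f : V -> W) p e :
  bsat X (bren f p) e <-> bsat X p (e \o f).
Proof.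
elim: p W f e => {V} V /=.
- by move=> *; rewrite !teval_ren.
- by move=> *; rewrite !teval_ren.
- by move=> *; rewrite !teval_ren.
- by move=> *; rewrite !teval_ren.
- by move=> p IHp W f e; rewrite IHp.
- by move=> p IHp q IHq W f e; rewrite IHp IHq.
- by move=> p IHp q IHq W f e; rewrite IHp IHq.
- move=> t p IHp W f e; rewrite teval_ren.
  by split=> H x /H; rewrite IHp scons_ren.
- move=> t p IHp W f e; rewrite teval_ren.
  by split=> -[x ltx H]; exists x => //; move: H; rewrite IHp scons_ren.
Qed.

Definition polynomial_in V (g : (V -> nat) -> nat) : Prop :=
  exists t : term V, forall e, teval e t = g e.

Lemma poly_var V (v : V) : polynomial_in (fun e => e v).
Proof. by exists (Var v). Qed.

Lemma poly_zero V : polynomial_in (fun _ : V -> nat => 0).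
Proof. by exists (@Zero V). Qed.

Lemma poly_add V (g h : (V -> nat) -> nat) :
  polynomial_in g -> polynomial_in h -> polynomial_in (fun e => g e + h e).
Proof. by move=> [t tg] [u uh]; exists (Add t u) => e /=; rewrite tg uh. Qed.

Lemma poly_mul V (g h : (V -> nat) -> nat) :
  polynomial_in g -> polynomial_in h -> polynomial_in (fun e => g e * h e).
Proof. by move=> [t tg] [u uh]; exists (Mul t u) => e /=; rewrite tg uh. Qed.

Lemma poly_succ V (g : (V -> nat) -> nat) :
  polynomial_in g -> polynomial_in (fun e => (g e).+1).
Proof. by move=> [t tg]; exists (Add t (@One V)) => e /=; rewrite tg addn1. Qed.

Lemma poly_cst V n : polynomial_in (fun _ : V -> nat => n).
Proof. by elim: n => [|n IHn]; [apply: poly_zero | apply: poly_succ]. Qed.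

(** * Bounded and Sigma_1 definability with parameter C *)

Section Definability.

Variable C : set nat.

(** Definability is a property of predicates on environments, so that the closure lemmas below
    replace the writing of explicit formulas. *)
Definition delta0 V (P : (V -> nat) -> Prop) : Prop :=
  exists p : bformula V, forall e, bsat C p e <-> P e.

Lemma delta0_ext V (P Q : (V -> nat) -> Prop) :
  (forall e, P e <-> Q e) -> delta0 P -> delta0 Q.
Proof. by move=> PQ [p pP]; exists p => e; rewrite pP. Qed.

Lemma delta0_ren V W (f : V -> W) (P : (V -> nat) -> Prop) :
  delta0 P -> delta0 (fun e => P (e \o f)).
Proof. by move=> [p pP]; exists (bren f p) => e; rewrite bsat_ren. Qed.

Lemma delta0_eq V (g h : (V -> nat) -> nat) :
  polynomial_in g -> polynomial_in h -> delta0 (fun e => g e = h e).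
Proof. by move=> [t tg] [u uh]; exists (Eq t u) => e /=; rewrite tg uh. Qed.

Lemma delta0_lt V (g h : (V -> nat) -> nat) :
  polynomial_in g -> polynomial_in h -> delta0 (fun e => g e < h e).
Proof. by move=> [t tg] [u uh]; exists (Lt t u) => e /=; rewrite tg uh. Qed.

Lemma delta0_in_fin V (g h : (V -> nat) -> nat) :
  polynomial_in g -> polynomial_in h -> delta0 (fun e => in_fin (g e) (h e)).
Proof. by move=> [t tg] [u uh]; exists (InFin t u) => e /=; rewrite tg uh. Qed.

Lemma delta0_param V (g : (V -> nat) -> nat) :
  polynomial_in g -> delta0 (fun e => C (g e)).
Proof. by move=> [t tg]; exists (InParam t) => e /=; rewrite tg. Qed.

Lemma delta0_not V (P : (V -> nat) -> Prop) :
  delta0 P -> delta0 (fun e => ~ P e).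
Proof. by move=> [p pP]; exists (Not p) => e /=; rewrite pP. Qed.

Lemma delta0_and V (P Q : (V -> nat) -> Prop) :
  delta0 P -> delta0 Q -> delta0 (fun e => P e /\ Q e).
Proof. by move=> [p pP] [q qQ]; exists (And p q) => e /=; rewrite pP qQ. Qed.

Lemma delta0_or V (P Q : (V -> nat) -> Prop) :
  delta0 P -> delta0 Q -> delta0 (fun e => P e \/ Q e).
Proof. by move=> [p pP] [q qQ]; exists (Or p q) => e /=; rewrite pP qQ. Qed.

Lemma delta0_all V (g : (V -> nat) -> nat) (P : nat -> (V -> nat) -> Prop) :
  polynomial_in g ->
  delta0 (fun e : option V -> nat => P (e None) (e \o Some)) ->
  delta0 (fun e => forall x, x < g e -> P x e).
Proof.
move=> [t tg] [p pP]; exists (AllLt t p) => e /=; rewrite tg.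
by split=> H x /H; rewrite pP.
Qed.

Lemma delta0_ex V (g : (V -> nat) -> nat) (P : nat -> (V -> nat) -> Prop) :
  polynomial_in g ->
  delta0 (fun e : option V -> nat => P (e None) (e \o Some)) ->
  delta0 (fun e => exists2 x, x < g e & P x e).
Proof.
move=> [t tg] [p pP]; exists (ExLt t p) => e /=; rewrite tg.
by split=> -[x ltx H]; exists x => //; move: H; rewrite pP.
Qed.

Definition sigma1_def V (P : (V -> nat) -> Prop) : Prop :=
  exists2 Q : nat -> (V -> nat) -> Prop,
    delta0 (fun e : option V -> nat => Q (e None) (e \o Some)) &
    forall e, P e <-> exists x, Q x e.

Lemma sigma1_def_sat V (P : (V -> nat) -> Prop) : sigma1_def P ->
  exists phi : sigma1 V, forall e, sat C phi e <-> P e.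
Proof.
move=> [Q [p pQ] PQ]; exists (Exists p) => e /=; rewrite PQ.
by split=> -[x Hx]; exists x; move: Hx; rewrite pQ.
Qed.

Lemma sigma1_ext V (P Q : (V -> nat) -> Prop) :
  (forall e, P e <-> Q e) -> sigma1_def P -> sigma1_def Q.
Proof. by move=> PQ [p dp pP]; exists p => // e; rewrite -PQ. Qed.

Lemma sigma1_ren V W (f : V -> W) (P : (V -> nat) -> Prop) :
  sigma1_def P -> sigma1_def (fun e => P (e \o f)).
Proof.
move=> [Q dQ PQ]; exists (fun x e => Q x (e \o f)) => //.
exact: delta0_ren (omap f) _ dQ.
Qed.

Lemma delta0_sigma1 V (P : (V -> nat) -> Prop) : delta0 P -> sigma1_def P.
Proof.
move=> dP; exists (fun=> P); first exact: delta0_ren Some _ dP.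
by move=> e; split=> [|[]//]; exists 0.
Qed.

(** Only one unbounded quantifier is available: it bounds both witnesses, which are then found by
    bounded search. [sigma1_ex] merges two quantifiers in the same way. *)
Lemma sigma1_and V (P Q : (V -> nat) -> Prop) :
  sigma1_def P -> sigma1_def Q -> sigma1_def (fun e => P e /\ Q e).
Proof.
move=> [P' dP PP'] [Q' dQ QQ'].
exists (fun z e => (exists2 x, x < z & P' x e) /\ (exists2 x, x < z & Q' x e)).
  apply: delta0_and; apply: delta0_ex (poly_var _) _.
    exact: delta0_ren (omap Some) _ dP.
  exact: delta0_ren (omap Some) _ dQ.
move=> e; rewrite PP' QQ'; split=> [[[x Px] [y Qy]]|].
  exists (x + y).+1; split; [exists x | exists y] => //; rewrite ltnS.
    exact: leq_addr.
  exact: leq_addl.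
by move=> [z [[x _ Px] [y _ Qy]]]; split; [exists x | exists y].
Qed.

Lemma sigma1_or V (P Q : (V -> nat) -> Prop) :
  sigma1_def P -> sigma1_def Q -> sigma1_def (fun e => P e \/ Q e).
Proof.
move=> [P' dP PP'] [Q' dQ QQ'].
exists (fun z e => P' z e \/ Q' z e); first exact: delta0_or.
move=> e; rewrite PP' QQ'; split=> [[[x]|[x]]|[x []]].
- by exists x; left.
- by exists x; right.
- by left; exists x.
- by right; exists x.
Qed.

Lemma sigma1_imp V (P Q : (V -> nat) -> Prop) :
  delta0 P -> sigma1_def Q -> sigma1_def (fun e => P e -> Q e).
Proof.
move=> dP sQ; apply: (@sigma1_ext _ (fun e => ~ P e \/ Q e)).
  by move=> e; have [] := pselect (P e); tauto.
exact/sigma1_or/sQ/delta0_sigma1/delta0_not.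
Qed.

Lemma sigma1_ex V (P : nat -> (V -> nat) -> Prop) :
  sigma1_def (fun e : option V -> nat => P (e None) (e \o Some)) ->
  sigma1_def (fun e => exists x, P x e).
Proof.
move=> [Q dQ PQ].
exists (fun z e => exists2 x, x < z & exists2 y, y < z & Q y (scons x e)).
  apply: delta0_ex (poly_var _) _; apply: delta0_ex (poly_var _) _.
  apply: delta0_ext (delta0_ren (omap (omap Some)) dQ) => e.
  rewrite (_ : scons _ _ = (e \o omap (omap Some)) \o Some) //.
  by apply: funext => -[].
move=> e; split=> [[x /(PQ (scons x e)) [y Qy]]|].
  exists (x + y).+1; exists x; first by rewrite ltnS leq_addr.
  by exists y => //; rewrite ltnS leq_addl.
by move=> [z [x _ [y _ Qy]]]; exists x; apply/(PQ (scons x e)); exists y.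
Qed.

(** This is Sigma_1 collection: the finitely many witnesses have a common bound, which becomes the
    single unbounded quantifier. *)
Lemma sigma1_all V (g : (V -> nat) -> nat) (P : nat -> (V -> nat) -> Prop) :
  polynomial_in g ->
  sigma1_def (fun e : option V -> nat => P (e None) (e \o Some)) ->
  sigma1_def (fun e => forall x, x < g e -> P x e).
Proof.
move=> [t tg] [Q dQ PQ].
exists (fun z e => forall x, x < g e -> exists2 y, y < z & Q y (scons x e)).
  apply: delta0_all; first by exists (tren Some t) => e; rewrite teval_ren tg.
  apply: delta0_ex (poly_var _) _.
  apply: delta0_ext (delta0_ren (omap (omap Some)) dQ) => e.
  rewrite (_ : scons _ _ = (e \o omap (omap Some)) \o Some) //.
  by apply: funext => -[].
move=> e; split=> [H|[z H] x /H [y _ Qy]]; last first.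
  by apply/(PQ (scons x e)); exists y.
apply: uniform_bound => [x y z leyz [w ltw Qw]|x /H /(PQ (scons x e)) [y Qy]].
  by exists w => //; apply: leq_trans ltw leyz.
by exists y.+1, y.
Qed.

Lemma sigma1_all_in V (I : eqType) (s : seq I) (P : I -> (V -> nat) -> Prop) :
  (forall i, sigma1_def (P i)) ->
  sigma1_def (fun e => forall i, i \in s -> P i e).
Proof.
move=> sP; elim: s => [|j s IHs].
  apply: sigma1_ext (delta0_sigma1 (delta0_eq (poly_zero V) (poly_zero V))).
  by [].
apply: sigma1_ext (sigma1_and (sP j) IHs) => e; split=> [[Pj Ps] i|H].
  by rewrite inE => /predU1P[->|/Ps].
by split=> [|i si]; apply: H; rewrite inE ?eqxx ?si ?orbT.
Qed.

(** * Graphs of functions recursive in C *)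

Definition fcons T k (x : T) (r : 'I_k -> T) : 'I_k.+1 -> T :=
  fun i => oapp r x (unlift ord0 i).

Lemma comp_fcons T U k (f : T -> U) x (r : 'I_k -> T) :
  f \o fcons x r = fcons (f x) (f \o r).
Proof. by apply: funext => i /=; rewrite /fcons; case: unlift. Qed.

Lemma fcons_eta T k (r : 'I_k.+1 -> T) : fcons (r ord0) (r \o lift ord0) = r.
Proof.
by apply: funext => i; rewrite /fcons; case: unliftP => [j|] ->.
Qed.

Lemma cons_mktuple k x (r : 'I_k -> nat) :
  [tuple of x :: mktuple r] = mktuple (fcons x r).
Proof.
apply: eq_from_tnth => i; rewrite tnth_mktuple /fcons.
case: unliftP => [j|] -> //.
by rewrite tnthS tnth_mktuple.
Qed.

Lemma behead_mktuple k (r : 'I_k.+1 -> nat) :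
  [tuple of behead (mktuple r)] = mktuple (r \o lift ord0).
Proof.
apply: val_inj.
have := congr1 (behead \o val) (cons_mktuple (r ord0) (r \o lift ord0)).
by rewrite fcons_eta /= => <-.
Qed.

(** Coordinate 0 is split off and quantified separately. Composition of recursive functions needs
    this for the tuple of its intermediate values. *)
Lemma sigma1_exfun V k (P : ('I_k -> nat) -> (V -> nat) -> Prop) :
  sigma1_def (fun e : 'I_k + V -> nat => P (e \o inl) (e \o inr)) ->
  sigma1_def (fun e => exists r, P r e).
Proof.
elim: k V P => [|k IHk] V P sP.
  have z0 : 'I_0 -> nat by case.
  have f0 : 'I_0 -> V by case.
  pose f (v : 'I_0 + V) : V := match v with inl i => f0 i | inr v => v end.
  have := sigma1_ren f sP; apply: sigma1_ext => e.
  have P0 r r' : P r e <-> P r' e.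
    by have -> : r = r' by apply: funext; case.
  split=> [Pe|[r Pr]]; last exact/P0/Pr.
  by exists z0; apply/P0/Pe.
apply: (@sigma1_ext _ (fun e => exists r', exists x, P (fcons x r') e)).
  move=> e; split=> [[r' [x Px]]|[r Pr]]; first by exists (fcons x r').
  by exists (r \o lift ord0), (r ord0); rewrite fcons_eta.
apply: IHk; apply: sigma1_ex.
pose f (v : 'I_k.+1 + V) : option ('I_k + V) :=
  match v with
  | inl i => fcons None (Some \o inl) i
  | inr v => Some (inr v)
  end.
apply: sigma1_ext (sigma1_ren f sP) => e.
by rewrite -(comp_fcons e None (Some \o inl)).
Qed.

(* Injective, since i <= i + j < (i + j).+1 ^ 2 - (i + j) ^ 2. *)
Definition npair i j := (i + j) * (i + j) + i.

Lemma npair_inj i j i' j' : npair i j = npair i' j' -> i = i' /\ j = j'.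
Proof.
wlog le : i j i' j' / i + j <= i' + j'.
  move=> H; case: (leqP (i + j) (i' + j')) => [|/ltnW]; first exact: H.
  by move=> le E; have [] := H _ _ _ _ le (esym E).
rewrite /npair => E; suff Es : i + j = i' + j'.
  by move: E; rewrite Es => /addnI Ei; move: Es; rewrite Ei => /addnI.
apply/eqP; rewrite eqn_leq le leqNgt; apply/negP => lt.
have : (i + j).+1 * (i + j).+1 <= (i' + j') * (i' + j') by exact: leq_mul.
have := leq_addr j i; have := leq_addr i' ((i' + j') * (i' + j')).
rewrite -E => H1 H2 H3; have := leq_trans H3 H1.
rewrite mulSn mulnS addnA addnC leq_add2l addSn ltnNge (leq_trans H2) //.
exact: leq_addr.
Qed.

Lemma npair_ge i j : i <= npair i j /\ j <= npair i j.
Proof.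
rewrite /npair leq_addl; split=> //; apply: leq_trans (leq_addr _ _).
by case: (posnP (i + j)) => [/eqP|]; [rewrite addn_eq0 => /andP[_ /eqP->] |
  move=> ?; rewrite (leq_trans (leq_addl i j)) // leq_pmulr].
Qed.

Lemma poly_npair V (g h : (V -> nat) -> nat) :
  polynomial_in g -> polynomial_in h ->
  polynomial_in (fun e => npair (g e) (h e)).
Proof. by move=> pg ph; do 3?[apply: poly_add || apply: poly_mul]. Qed.

(* A finite set c of pairs is contained in the graph of the recursively       *)
(* defined function as soon as each of its elements is justified by another   *)
(* one.                                                                       *)
Lemma nat_rect_graph x (F : nat -> nat -> nat) n y :
  nat_rect (fun=> nat) x F n = y <->
  exists c, [/\ forall z, z < c -> in_fin (npair 0 z) c -> x = z,
    forall i, i < c -> forall z, z < c -> in_fin (npair i.+1 z) c ->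
      exists w, in_fin (npair i w) c /\ F i w = z
    & in_fin (npair n y) c].
Proof.
set h := nat_rect _ x F; split=> [<-|[c [c0 cS cn]]].
  have [N NP] := @uniform_bound (fun i N => npair i (h i) < N) n.+1
    (fun x y z leyz lt => leq_trans lt leyz)
    (fun i _ => ex_intro (fun N => is_true (npair i (h i) < N)) _ (ltnSn _)).
  have [c cP] := in_fin_code
    (fun p => exists2 i, i < n.+1 & p = npair i (h i)) N.
  exists c; split.
  - by move=> z _ /cP[_ [i _ /npair_inj[<- ->]]].
  - move=> i _ z _ /cP[_ [j ltj /npair_inj[Ej ->]]]; rewrite -Ej in ltj *.
    exists (h i); split=> //.
    by apply/cP; split; [apply/NP/ltnW | exists i => //; apply: ltnW].
  - by apply/cP; split; [apply: NP | exists n].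
elim: n y cn => [|n IHn] y cn /=.
  apply: c0 => //; apply: leq_trans (in_fin_lt cn); rewrite ltnS.
  exact: (npair_ge 0 y).2.
have := in_fin_lt cn; have [gen gey] := npair_ge n.+1 y => ltc.
have [||w [/IHn <- <-]] := cS n _ y _ cn => //.
  exact: leq_trans gen (ltnW ltc).
exact: leq_ltn_trans gey ltc.
Qed.

(** By induction on the construction of f. Arguments and value are arbitrary variables of a common
    environment, so that the induction hypotheses apply under further quantifiers. *)
Lemma recursive_graph k (f : k.-tuple nat -> nat) : recursive_in C f ->
  forall V (a : 'I_k -> V) (y : V),
    sigma1_def (fun e : V -> nat => f (mktuple (e \o a)) = e y).
Proof.
elim=> {k f}.
- move=> V a y; apply: delta0_sigma1; apply: delta0_eq; first exact: poly_zero.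
  exact: poly_var.
- move=> V a y; apply: (@sigma1_ext _ (fun e => (e (a ord0)).+1 = e y)).
    by move=> e; rewrite /thead tnth_mktuple.
  apply: delta0_sigma1; apply: delta0_eq; last exact: poly_var.
  exact/poly_succ/poly_var.
- move=> k i V a y; apply: (@sigma1_ext _ (fun e => e (a i) = e y)).
    by move=> e; rewrite tnth_mktuple.
  by apply: delta0_sigma1; apply: delta0_eq; apply: poly_var.
- move=> V a y; apply: (@sigma1_ext _ (fun e =>
    C (e (a ord0)) /\ 1 = e y \/ ~ C (e (a ord0)) /\ 0 = e y)).
    move=> e; rewrite /thead tnth_mktuple /=.
    case: (pselect (C (e (a ord0)))) => Ca.
      by rewrite (asboolT Ca); tauto.
    by rewrite (asboolF Ca); tauto.
  apply: delta0_sigma1; apply: delta0_or; apply: delta0_and.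
  + exact/delta0_param/poly_var.
  + by apply: delta0_eq; [apply: poly_cst | apply: poly_var].
  + exact/delta0_not/delta0_param/poly_var.
  + by apply: delta0_eq; [apply: poly_cst | apply: poly_var].
- move=> k l f g _ IHf _ IHg V a y.
  apply: (@sigma1_ext _ (fun e => exists r : 'I_l -> nat,
    f (mktuple r) = e y /\
    forall i, i \in enum 'I_l -> g i (mktuple (e \o a)) = r i)).
    move=> e; split=> [[r [<- gr]]|<-].
      by congr f; apply: eq_mktuple => i; rewrite gr ?mem_enum.
    by exists (fun i => g i (mktuple (e \o a))).
  apply: sigma1_exfun; apply: sigma1_and; first exact: (IHf _ inl (inr y)).
  apply: (@sigma1_all_in _ _ _ (fun i e => _)) => i.
  exact: (IHg i _ (inr \o a) (inl i)).
- move=> k f g _ IHf _ IHg V a y.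
  (* The number c codes a finite set of pairs recording the values of the recursion up to its
     argument, as in [nat_rect_graph]. *)
  apply: (@sigma1_ext _ (fun e => exists c,
    (forall z, z < c -> in_fin (npair 0 z) c ->
      f (mktuple (e \o a \o lift ord0)) = z) /\
    ((forall i, i < c -> forall z, z < c -> in_fin (npair i.+1 z) c ->
      exists w, in_fin (npair i w) c /\
        g (mktuple (fcons i (fcons w (e \o a \o lift ord0)))) = z) /\
    in_fin (npair (e (a ord0)) (e y)) c))).
    move=> e; rewrite nat_rect_graph behead_mktuple.
    have E i w :
        [tuple of i :: w :: behead (mktuple (e \o a))] =
        mktuple (fcons i (fcons w (e \o a \o lift ord0))).
      by rewrite -!cons_mktuple -behead_mktuple; apply: val_inj.
    rewrite /thead tnth_mktuple /=.
    split=> [[c [c0 [cS cn]]]|[c [c0 cS cn]]]; exists c; split=> //.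
      by move=> i lti z ltz /(cS i lti z ltz) [w]; rewrite -E; exists w.
    split=> // i lti z ltz /(cS i lti z ltz) [w].
    by rewrite E; exists w.
  apply: sigma1_ex; apply: sigma1_and; last apply: sigma1_and.
  + apply: sigma1_all (poly_var _) _; apply: sigma1_imp.
      apply: delta0_in_fin; last exact: poly_var.
      by apply: poly_npair; [apply: poly_cst | apply: poly_var].
    exact: (IHf _ (Some \o Some \o a \o lift ord0) None).
  + apply: sigma1_all (poly_var _) _; apply: sigma1_all (poly_var _) _.
    apply: sigma1_imp.
      apply: delta0_in_fin; last exact: poly_var.
      by apply: poly_npair; [apply/poly_succ/poly_var | apply: poly_var].
    apply: sigma1_ex; apply: sigma1_and.
      apply: delta0_sigma1; apply: delta0_in_fin; last exact: poly_var.
      by apply: poly_npair; apply: poly_var.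
    apply: sigma1_ext (IHg _ (fcons (Some (Some None)) (fcons None
      (Some \o Some \o Some \o Some \o a \o lift ord0))) (Some None)) => e.
    by rewrite !comp_fcons.
  + apply: delta0_sigma1; apply: delta0_in_fin; last exact: poly_var.
    by apply: poly_npair; apply: poly_var.
- move=> k f h _ IHf f0 fS V a y.
  (* That f does not vanish below the minimum is expressed by exhibiting its positive values, which
     keeps the statement Sigma_1. *)
  apply: (@sigma1_ext _ (fun e => (exists w,
      f (mktuple (fcons (e y) (e \o a))) = w /\ w = 0) /\
    forall x, x < e y -> exists w,
      f (mktuple (fcons x (e \o a))) = w /\ 0 < w)).
    move=> e; split=> [[[_ [<- fy]] fx]|<-]; last first.
      split=> [|x ltx].
        by exists 0; rewrite -cons_mktuple f0.
      exists (f (mktuple (fcons x (e \o a)))); split=> //.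
      by rewrite -cons_mktuple lt0n; apply/eqP/fS.
    apply/eqP; rewrite eqn_leq; apply/andP; split; rewrite leqNgt; apply/negP.
      by move=> /fS; rewrite cons_mktuple fy.
    by move=> /fx [w []]; rewrite -cons_mktuple f0 => <-.
  apply: sigma1_and.
    apply: sigma1_ex; apply: sigma1_and.
      apply: sigma1_ext (IHf _ (fcons (Some y) (Some \o a)) None) => e.
      by rewrite comp_fcons.
    by apply: delta0_sigma1; apply: delta0_eq (poly_var _) (poly_cst _ _).
  apply: sigma1_all (poly_var _) _.
  apply: sigma1_ex; apply: sigma1_and.
    apply: sigma1_ext (IHf _ (fcons (Some None) (Some \o Some \o a)) None) => e.
    by rewrite comp_fcons.
  by apply: delta0_sigma1; apply: delta0_lt (poly_cst _ _) (poly_var _).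
Qed.

End Definability.

(** * Mathias conditions and generic sets *)

Definition unbounded (Y : set nat) : Prop := forall n, exists2 x, n <= x & Y x.

Lemma unbounded_infinite (Y : set nat) : unbounded Y -> infinite_set Y.
Proof.
move=> uY /finite_fsetP[F YF].
have [x lex] := uY (\sum_(i <- F) i).+1; rewrite YF /= => Fx.
by move: lex; rewrite (big_rem x Fx) /= ltnNge leq_addr.
Qed.

Lemma unbounded_split (Y A : set nat) :
  unbounded Y -> unbounded (Y `&` A) \/ unbounded (Y `&` ~` A).
Proof.
move=> uY; apply: contrapT => /not_orP[/existsNP[n nA] /existsNP[m mA]].
have [x] := uY (maxn n m); rewrite geq_max => /andP[lenx lemx] Yx.
have [Ax|nAx] := pselect (A x); first by apply: nA; exists x.
by apply: mA; exists x.
Qed.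

(* A condition (b, Y) stands for the Mathias condition with finite part the   *)
(* elements of Y below b and reservoir the other elements of Y.               *)
Definition condition : Type := nat * set nat.

Definition compatible (c : condition) (G : set nat) : Prop :=
  G `<=` c.2 /\ forall x, x < c.1 -> c.2 x -> G x.

Definition extends (d c : condition) : Prop :=
  c.1 <= d.1 /\ compatible c d.2.

Lemma compatible_extends d c G :
  extends d c -> compatible d G -> compatible c G.
Proof.
move=> [ledc [sdc dc]] [sGd Gd]; split=> [x /sGd /sdc //|x ltx cx].
by apply: Gd; [apply: leq_trans ledc | apply: dc].
Qed.

Lemma extends_refl c : extends c c.
Proof. by split=> //; split. Qed.

Lemma extends_trans c d f : extends f d -> extends d c -> extends f c.
Proof.
move=> [lefd fd] edc; split; first exact: leq_trans edc.1 lefd.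
exact: compatible_extends edc fd.
Qed.

Section Forcing.

Variable C : set nat.

Definition sigma1_set (Y : set nat) : Prop :=
  sigma1_def C (fun e : unit -> nat => Y (e tt)).

Lemma sigma1_set_var (Y : set nat) V (v : V) :
  sigma1_set Y -> sigma1_def C (fun e => Y (e v)).
Proof. exact: sigma1_ren (fun=> v) _. Qed.

Definition valid (c : condition) : Prop := unbounded c.2 /\ sigma1_set c.2.

Definition dense (D : set nat -> Prop) : Prop :=
  forall c, valid c -> exists d,
    [/\ valid d, extends d c & forall G, compatible d G -> D G].

(** Stage s meets the requirement with code s, if there is one. The generic set is the intersection
    of all reservoirs, each of which includes its finite part. *)
Lemma generic_exists (I : Type) (code : I -> nat) (D : I -> set nat -> Prop) :
  injective code -> (forall i, dense (D i)) -> exists G, forall i, D i G.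
Proof.
move=> code_inj denseD.
pose step s (c d : condition) := [/\ valid d, extends d c &
  forall i, code i = s -> forall G, compatible d G -> D i G].
have /choice[next nextP] sc : exists d, valid sc.2 -> step sc.1 sc.2 d.
  (* The choice function must be total; on invalid conditions nothing is required of it. *)
  case: sc => s c /=; have [vc|nvc] := pselect (valid c); last by exists c.
  have [[i <-]|ni] := pselect (exists i, code i = s).
    have [d [vd edc dD]] := denseD i c vc.
    by exists d; split=> // j /code_inj ->.
  exists c; split=> //; first exact: extends_refl.
  by move=> i Ei; case: ni; exists i.
pose c := nat_rect (fun=> condition) (0, setT) (fun s c => next (s, c)).
have vc s : valid (c s).
  elim: s => [|s IHs]; last by have [] := nextP (s, c s) IHs.
  split=> [n|]; first by exists n.
  apply: delta0_sigma1.
  by apply: delta0_ext (delta0_eq C (poly_zero _) (poly_zero _)).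
have cS s : step s (c s) (c s.+1) := nextP (s, c s) (vc s).
have cE s t : s <= t -> extends (c t) (c s).
  elim: t => [|t IHt]; first by rewrite leqn0 => /eqP ->; apply: extends_refl.
  rewrite leq_eqVlt => /predU1P[->|/IHt]; first exact: extends_refl.
  by apply: extends_trans; have [] := cS t.
exists [set x | forall s, (c s).2 x] => i.
have [_ _ /(_ i erefl)] := cS (code i); apply.
split=> [x /(_ _) //|x ltx cx t].
(* Earlier conditions have larger reservoirs; later ones keep every element below the bound already
   fixed. *)
have [let_|lts] := leqP t (code i).+1; first exact: (cE _ _ let_).2.1.
by apply: (cE _ _ (ltnW lts)).2.2.
Qed.

Lemma dense_unbounded n : dense (fun G => exists2 x, n <= x & G x).
Proof.
move=> c [uc sc]; have [x lenx cx] := uc n.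
exists (maxn c.1 x.+1, c.2); split=> //=.
  by split; [rewrite /= leq_maxl | split].
by move=> G [_ cG]; exists x => //; apply: cG => //=; rewrite leq_maxr.
Qed.

Lemma restrict_condition (A : set nat) c :
  sigma1_set A -> valid c -> unbounded (c.2 `&` A) -> exists d,
    [/\ valid d, extends d c & forall G, compatible d G -> almost_subset G A].
Proof.
move=> sA [uc sc] uA.
(* Elements below [c.1] belong to the finite part and stay, so inclusion in A holds only up to
   finitely many elements. *)
exists (c.1, [set x | c.2 x /\ (x < c.1 \/ A x)]); split.
- split=> [n|].
    have [x lenx [cx Ax]] := uA n.
    by exists x => //; split=> //; right.
  apply: sigma1_and => //; apply: sigma1_or => //.
  by apply: delta0_sigma1; apply: delta0_lt (poly_var _) (poly_cst _ _).
- by split=> //; split=> [x []|] //= x ltx cx; split=> //; left.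
- move=> G [sG _]; apply: sub_finite_set (finite_II c.1) => x [/sG[_ []]] //.
Qed.

Lemma dense_decide (A : set nat) : sigma1_set A -> sigma1_set (~` A) ->
  dense (fun G => almost_subset G A \/ almost_subset G (~` A)).
Proof.
move=> sA snA c vc; have [uA|uA] := unbounded_split A vc.1.
  have [d [vd edc dA]] := restrict_condition sA vc uA.
  by exists d; split=> // G /dA; left.
have [d [vd edc dA]] := restrict_condition snA vc uA.
by exists d; split=> // G /dA; right.
Qed.

Lemma uniformly_computable_sigma1 (R : nat -> set nat) i :
  uniformly_computable C R -> sigma1_set (R i) /\ sigma1_set (~` R i).
Proof.
move=> hR.
have sb b : sigma1_set [set x | nat_of_bool `[< R i x >] = b].
  (* The constants i and b become quantified variables, since [recursive_graph] accepts only
     variables. *)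
  apply: (@sigma1_ext _ _ (fun e : unit -> nat => exists j, j = i /\
      exists y, y = b /\ nat_of_bool `[< R j (e tt) >] = y)).
    move=> e; split=> [[_ [-> [_ [->]]]]|<-] //.
    by exists i; split=> //; eexists.
  apply: sigma1_ex; apply: sigma1_and.
    by apply: delta0_sigma1; apply: delta0_eq (poly_var _) (poly_cst _ _).
  apply: sigma1_ex; apply: sigma1_and.
    by apply: delta0_sigma1; apply: delta0_eq (poly_var _) (poly_cst _ _).
  pose a (j : 'I_2) : option (option unit) :=
    if j == ord0 then Some None else Some (Some tt).
  by apply: sigma1_ext (recursive_graph hR a None) => e; rewrite !tnth_mktuple.
split.
  by apply: sigma1_ext (sb 1) => e /=; case: asboolP.
by apply: sigma1_ext (sb 0) => e /=; case: asboolP.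
Qed.

(** * Forcing the fairness requirements *)

(** A query to the join is replaced according to parity: odd numbers ask C, even ones ask the finite
    set coded by the variable s. The half is found by bounded search, so the result is a bounded
    formula in C alone. *)
Lemma delta0_join V W (p : bformula V) (f : V -> W) (s : W) :
  delta0 C (fun e : W -> nat =>
    bsat (join [set x | in_fin x (e s)] C) p (e \o f)).
Proof.
have pol U X (h : U -> X) t :
    polynomial_in (fun e : X -> nat => teval (e \o h) t).
  by exists (tren h t) => e; rewrite teval_ren.
elim: p W f s => {V} V /=.
- by move=> t u W f s; apply: delta0_eq.
- by move=> t u W f s; apply: delta0_lt.
- move=> t W f s.
  apply: (@delta0_ext _ _ (fun e => let x := teval (e \o f) t in
    (exists2 h, h < x.+1 & x = (h + h).+1 /\ C h) \/
    (exists2 h, h < x.+1 & x = h + h /\ in_fin h (e s)))).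
    move=> e /=; set x := teval _ _; rewrite /join /=; split.
      case=> -[h _ [->]]; rewrite addnn /= odd_double ?uphalf_double //.
      by rewrite doubleK.
    move=> xP; have := odd_double_half x; rewrite -addnn.
    case: (odd x) xP => xP Ex; [left | right]; exists x./2;
      by rewrite // ltnS -[leqRHS]Ex ?leq_addr // add1n ltnW // ltnS leq_addr.
  apply: delta0_or; apply: delta0_ex (poly_succ (pol _ _ _ _)) _;
    apply: delta0_and.
  + apply: delta0_eq; first exact: (pol _ _ (Some \o f)).
    by apply: poly_succ; apply: poly_add; apply: poly_var.
  + exact/delta0_param/poly_var.
  + apply: delta0_eq; first exact: (pol _ _ (Some \o f)).
    by apply: poly_add; apply: poly_var.
  + by apply: delta0_in_fin; apply: poly_var.
- by move=> t u W f s; apply: delta0_in_fin.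
- by move=> p IHp W f s; apply: delta0_not.
- by move=> p IHp q IHq W f s; apply: delta0_and.
- by move=> p IHp q IHq W f s; apply: delta0_or.
- move=> t p IHp W f s; apply: delta0_all => //.
  apply: delta0_ext (IHp _ (omap f) (Some s)) => e.
  rewrite (_ : scons _ _ = e \o omap f) //.
  by apply: funext => -[].
- move=> t p IHp W f s; apply: delta0_ex => //.
  apply: delta0_ext (IHp _ (omap f) (Some s)) => e.
  rewrite (_ : scons _ _ = e \o omap f) //.
  by apply: funext => -[].
Qed.

Lemma sat_join_use V (phi : sigma1 V) (G : set nat) e :
  sat (join G C) phi e -> exists n, forall G',
    (forall x, x < n -> (G x <-> G' x)) -> sat (join G' C) phi e.
Proof.
case: phi => p [x px]; have [n np] := bsat_use p (join G C) (scons x e).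
exists n => G' GG'; exists x; apply/(np (join G' C)) => // y lty.
rewrite /join /=; case: odd => //; apply: GG'.
apply: leq_ltn_trans lty.
by rewrite -{2}(odd_double_half y) -addnn addnA leq_addl.
Qed.

(** The formula says that some finite s inside the reservoir Y, containing the elements below b of
    the set coded by y, makes phi true. The bound [h < s] loses nothing, as elements are smaller
    than the index of their set. *)
Lemma sigma1_extension V (phi : sigma1 V) (Y : set nat) y b :
  sigma1_set Y -> sigma1_def C (fun e => exists s,
    [/\ forall h, h < s -> in_fin h s -> Y h,
        forall h, h < b -> in_fin h y -> in_fin h s
      & sat (join [set x | in_fin x s] C) phi e]).
Proof.
move=> sY; case: phi => p /=.
apply: (@sigma1_ext _ _ (fun e => exists s,
  (forall h, h < s -> in_fin h s -> Y h) /\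
  ((forall h, h < b -> in_fin h y -> in_fin h s) /\
  exists x, bsat (join [set x | in_fin x s] C) p (scons x e)))).
  by move=> e; split=> [[s [? [? ?]]]|[s [? ? ?]]]; exists s.
apply: sigma1_ex; apply: sigma1_and; last apply: sigma1_and.
- apply: sigma1_all (poly_var _) _; apply: sigma1_imp.
    by apply: delta0_in_fin; apply: poly_var.
  exact: sigma1_set_var.
- apply: sigma1_all (poly_cst _ _) _; apply: sigma1_imp.
    exact: delta0_in_fin (poly_var _) (poly_cst _ _).
  by apply: delta0_sigma1; apply: delta0_in_fin; apply: poly_var.
- apply: sigma1_ex; apply: delta0_sigma1.
  apply: delta0_ext (delta0_join p (omap Some) (Some None)) => e.
  rewrite (_ : scons _ _ = e \o omap Some) //.
  by apply: funext => -[].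
Qed.

Lemma dense_fair n (A0 A1 : set rat) m (M : 'M[rat]_(m, 2 ^ n * m))
    (phi : sigma1 (Mvar m (2 ^ n * m))) :
  ER_fair n A0 A1 C -> increasing_rows M ->
  dense (fun G => essential (@Msat (join G C) _ _ M phi) ->
    exists2 V : valuation M, diagonalizes V A0 A1 & Msat (join G C) phi V).
Proof.
move=> fairC incM [b Y] [/= uY sY].
have [y yP] := in_fin_code Y b.
have [psi psiP] := sigma1_def_sat (sigma1_extension phi y b sY).
have [ess|ness] := pselect (essential (@Msat C _ _ M psi)).
  have [V diagV /psiP[s [sub ext]]] := fairC _ _ _ incM ess.
  move=> /sat_join_use[k use].
  (* The new bound exceeds the use k, the old bound b, and all elements of the set coded by s. Every
     compatible G therefore contains that set and agrees with it below k. *)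
  exists (k + b + s, [set x | Y x /\ (in_fin x s \/ k + b + s <= x)]); split.
  - split=> [i|/=].
      have [x] := uY (maxn i (k + b + s)).
      rewrite geq_max => /andP[leix lex] Yx; exists x => //.
      by split=> //; right.
    apply: sigma1_and => //; apply: delta0_sigma1; apply: delta0_or.
      exact: delta0_in_fin (poly_var _) (poly_cst _ _).
    apply: (@delta0_ext _ _ (fun e => k + b + s < (e tt).+1)) => //.
    exact: delta0_lt (poly_cst _ _) (poly_succ (poly_var _)).
  - split=> /=; first by rewrite -addnA addnCA leq_addr.
    split=> [x []|x /= ltx Yx] //; split=> //; left.
    by apply: ext => //; apply/yP.
  - move=> G [/= sG Gs] _; exists V => //; apply: use => x ltx /=.
    split=> [sx|/sG[_ []//]]; last first.
      by rewrite leqNgt -addnA ltn_addr.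
    have ltxs := in_fin_lt sx; apply: Gs; first exact: ltn_addl.
    by split; [apply: sub | left].
(* The condition is left unchanged: if phi were essential for a compatible G, sufficiently long
   initial segments of G would make [psi] essential with the same partition and type. *)
exists (b, Y); split=> //; first exact: extends_refl.
move=> G [/= sG Gb] [I [T [partI typeT essT]]]; case: ness.
exists I, T; split=> // s; have [V [gtV typeV]] := essT s.
move=> /sat_join_use[k use]; exists V; split=> //; apply/psiP.
(* Cutting G at [k + b] preserves both the use of the computation and the finite part of the
   condition. *)
have [t tP] := in_fin_code G (k + b); exists t; split.
- by move=> h _ /tP[_ /sG].
- by move=> h lth /yP[_ /(Gb h lth) Gh]; apply/tP; rewrite ltn_addl.
- apply: use => x ltx; split=> [Gx|/tP[]//].
  by apply/tP; rewrite ltn_addr.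
Qed.

End Forcing.

(** * Countability of the requirements *)

Fixpoint term_tree V (i : V -> nat) (t : term V) : GenTree.tree nat :=
  match t with
  | Var v => GenTree.Leaf (i v)
  | Zero => GenTree.Node 0 [::]
  | One => GenTree.Node 1 [::]
  | Add t u => GenTree.Node 2 [:: term_tree i t; term_tree i u]
  | Mul t u => GenTree.Node 3 [:: term_tree i t; term_tree i u]
  end.

(** Under a quantifier, 0 is reserved for the newly bound variable and the other indices shift by
    one. *)
Definition option_index V (i : V -> nat) (v : option V) : nat :=
  oapp (fun v => (i v).+1) 0 v.

Fixpoint bformula_tree V (i : V -> nat) (p : bformula V) : GenTree.tree nat :=
  match p with
  | Eq t u => GenTree.Node 0 [:: term_tree i t; term_tree i u]
  | Lt t u => GenTree.Node 1 [:: term_tree i t; term_tree i u]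
  | InParam t => GenTree.Node 2 [:: term_tree i t]
  | InFin t u => GenTree.Node 3 [:: term_tree i t; term_tree i u]
  | Not p => GenTree.Node 4 [:: bformula_tree i p]
  | And p q => GenTree.Node 5 [:: bformula_tree i p; bformula_tree i q]
  | Or p q => GenTree.Node 6 [:: bformula_tree i p; bformula_tree i q]
  | AllLt t p =>
      GenTree.Node 7 [:: term_tree i t; bformula_tree (option_index i) p]
  | ExLt t p =>
      GenTree.Node 8 [:: term_tree i t; bformula_tree (option_index i) p]
  end.

Lemma term_tree_inj V (i : V -> nat) : injective i -> injective (term_tree i).
Proof.
move=> i_inj; elim=> [v||| t IHt u IHu | t IHt u IHu] [w||| t' u' | t' u'] //=.
- by case=> /i_inj ->.
- by case=> /IHt -> /IHu ->.
- by case=> /IHt -> /IHu ->.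
Qed.

Lemma option_index_inj V (i : V -> nat) :
  injective i -> injective (option_index i).
Proof. by move=> i_inj [v|] [w|] //= [/i_inj ->]. Qed.

Lemma bformula_tree_inj V (i : V -> nat) :
  injective i -> injective (bformula_tree i).
Proof.
move=> i_inj p; elim: p i i_inj => {V} V.
- by move=> t u i ii [] //= t' u' [/(term_tree_inj ii)-> /(term_tree_inj ii)->].
- by move=> t u i ii [] //= t' u' [/(term_tree_inj ii)-> /(term_tree_inj ii)->].
- by move=> t i ii [] //= t' [/(term_tree_inj ii)->].
- by move=> t u i ii [] //= t' u' [/(term_tree_inj ii)-> /(term_tree_inj ii)->].
- by move=> p IHp i ii [] //= p' [/(IHp i ii)->].
- by move=> p IHp q IHq i ii [] //= p' q' [/(IHp i ii)-> /(IHq i ii)->].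
- by move=> p IHp q IHq i ii [] //= p' q' [/(IHp i ii)-> /(IHq i ii)->].
- move=> t p IHp i ii [] //= t' p' [/(term_tree_inj ii)->].
  by move/(IHp _ (option_index_inj ii))->.
- move=> t p IHp i ii [] //= t' p' [/(term_tree_inj ii)->].
  by move/(IHp _ (option_index_inj ii))->.
Qed.

Definition requirement n : Type :=
  {m : nat & ('M[rat]_(m, 2 ^ n * m) * sigma1 (Mvar m (2 ^ n * m)))%type}.

Lemma requirement_code n : exists code : requirement n -> nat, injective code.
Proof.
pose i m (v : Mvar m (2 ^ n * m)) := choice.pickle v.
have i_inj m : injective (@i m) by apply: pcan_inj (@choice.pickleK _).
pose tr (r : requirement n) :
    {m : nat & ('M[rat]_(m, 2 ^ n * m) * GenTree.tree nat)%type} :=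
  let: existT m (M, Exists p) := r in
  existT _ m (M, bformula_tree (option_index (@i m)) p).
exists (fun r => choice.pickle (tr r)).
apply: inj_comp; first exact: pcan_inj (@choice.pickleK _).
move=> [m [M [p]]] [m' [M' [p']]] /= E.
have Em : m = m' by case: E.
(* Once the dimensions are identified, equality of the dependent pairs gives equality of their
   second components. *)
case: m' / Em M' p' E => M' p' /eqP; rewrite eq_Tagged => /eqP [-> ].
by move/(bformula_tree_inj (option_index_inj (@i_inj m)))->.
Qed.

Theorem theorem5p20 (n : nat) (A0 A1 : set rat) (C : set nat)
    (hC : ER_fair n A0 A1 C) (R : nat -> set nat)
    (hR : uniformly_computable C R) :
  exists G : set nat, cohesive R G /\ ER_fair n A0 A1 (join G C).
Proof.
have [code code_inj] := requirement_code n.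
(* The three kinds of requirement are infinity, cohesiveness and fairness. Increasing rows are a
   premise of the last kind, so a matrix without them is satisfied trivially. *)
pose D (r : nat + nat + requirement n) (G : set nat) : Prop :=
  match r with
  | inl (inl k) => exists2 x, k <= x & G x
  | inl (inr k) => almost_subset G (R k) \/ almost_subset G (~` R k)
  | inr (existT m (M, phi)) => increasing_rows M ->
      essential (@Msat (join G C) _ _ M phi) ->
      exists2 V : valuation M, diagonalizes V A0 A1 & Msat (join G C) phi V
  end.
pose code' (r : nat + nat + requirement n) :=
  choice.pickle (match r with inl k => inl k | inr r => inr (code r) end).
have [||G DG] := @generic_exists C _ code' D.
- apply: inj_comp; first exact: pcan_inj (@choice.pickleK _).
  by move=> [k|r] [k'|r'] // [] => [->|/code_inj ->].
- move=> [[k|k]|[m [M phi]]] /=.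
  + exact: dense_unbounded.
  + by have [sR snR] := uniformly_computable_sigma1 k hR; apply: dense_decide.
  + have [incM|nincM] := pselect (increasing_rows M); last first.
      by move=> c vc; exists c; split=> // [|G _ /nincM//]; apply: extends_refl.
    move=> c /(dense_fair phi hC incM)[d [vd edc dP]].
    by exists d; split=> // G /dP dG _.
exists G; split.
  split; last by move=> k; apply: (DG (inl (inr k))).
  by apply: unbounded_infinite => k; apply: (DG (inl (inl k))).
by move=> m M phi; apply: (DG (inr (existT _ m (M, phi)))).
Qed.
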